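(* Let $S$ be an infinite discrete semigroup that is countable, weakly cancellative, and has a uniform, finite bound on $|\mathrm{Fix}(a)|$ for $a\in S$ (i.e. there is $k\in\mathbb{N}$ with $|\mathrm{Fix}(a)|\le k$ for all $a\in S$). Let $R$ be a minimal right ideal of $S^*$ and let $r\in R$. Then every $q\in r\cdot E(R)$ is a $P$-point of $\overline{r\cdot E(R)}$. In particular, $r\cdot E(R)$ is a $P$-space.
   Context: $\beta S$ is the set of ultrafilters on $S$ (principal ultrafilters identified with points of $S$), with the topology whose basic clopen sets are $\overline{A}=\{p\in\beta S: A\in p\}$, $A\subseteq S$; closures of subsets of $\beta S$ are taken in $\beta S$, and $S^*=\beta S\setminus S$. The operation of $S$ extends to $\beta S$ by: $A\in p\cdot q$ iff $\{x\in S: x^{-1}A\in q\}\in p$, where $x^{-1}A=\{y\in S: x\cdot y\in A\}$. This makes $\beta S$ a compact Hausdorff right topological semigroup. $E(R)$ is the set of idempotents in $R$, and $r\cdot E(R)=\{r\cdot e: e\in E(R)\}$, with the subspace topology. $S$ is weakly cancellative if for all $a,b\in S$ the sets $\{x\in S: ax=b\}$ and $\{x\in S: xa=b\}$ are finite. In this case $S^*$ is a two-sided ideal of $\beta S$ (hence a semigroup), and the minimal right ideals of $S^*$ are exactly those of $\beta S$. For $a\in S$, $\mathrm{Fix}(a)=\{x\in S: xa=a\}$. A point $x$ of a space $X$ is a $P$-point of $X$ if every countable intersection of neighborhoods of $x$ is a neighborhood of $x$; $X$ is a $P$-space if all its points are $P$-points (equivalently, countable intersections of open sets are open). *)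

(* Defs.v *)
From HB Require Import structures.
From mathcomp Require Import all_boot monoid all_classical topology.

Set Implicit Arguments.
Unset Strict Implicit.
Unset Printing Implicit Defensive.

Local Open Scope classical_set_scope.

Section UltrafilterSpace.
Variable S : Type.

Record stone_cech := StoneCech {
  ultra :> set_system S ;
  ultraP : UltraFilter ultra }.

HB.instance Definition _ := gen_eqMixin stone_cech.
HB.instance Definition _ := gen_choiceMixin stone_cech.

Lemma ultra_inj (p q : stone_cech) : (forall A, ultra p A <-> ultra q A) -> p = q.
Proof.
case: p => p pP; case: q => q qP /= pq.
have e : p = q by apply/funext => A; apply/propext.
by rewrite e in pP *; congr StoneCech; exact: Prop_irrelevance.
Qed.

Definition basic_clopen (A : set S) : set stone_cech := [set p | ultra p A].

Let basic_cover : \bigcup_(A in [set: set S]) basic_clopen A = [set: stone_cech].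
Proof.
apply/seteqP; split=> // p _; exists [set: S] => //.
have := ultraP p => pU; exact: filterT.
Qed.

Let basic_join (A B : set S) (p : stone_cech) :
  [set: set S] A -> [set: set S] B -> basic_clopen A p -> basic_clopen B p ->
  exists C : set S, [/\ [set: set S] C, basic_clopen C p &
    basic_clopen C `<=` basic_clopen A `&` basic_clopen B].
Proof.
move=> _ _ pA pB; exists (A `&` B); split=> //.
  by have := ultraP p => pU; exact: filterI.
by move=> q qAB; have := ultraP q => qU; split; apply: filterS qAB => x [].
Qed.

HB.instance Definition _ :=
  isBaseTopological.Build stone_cech basic_cover basic_join.

Definition principal (x : S) : stone_cech :=
  StoneCech (principal_filter_ultra x).

(* S^*, with S identified with the principal ultrafilters *)
Definition remainder : set stone_cech := ~` range principal.

End UltrafilterSpace.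

Arguments remainder S : clear implicits.

Section Product.
Variable S : semigroupType.
Local Open Scope group_scope.

(* x^-1 A *)
Definition ltrans_preimage (x : S) (A : set S) : set S := [set y | A (x * y)].

Definition ultra_mul_set (p q : set_system S) : set_system S :=
  [set A | p [set x | q (ltrans_preimage x A)]].

Lemma ultra_mul_ultra (p q : stone_cech S) : UltraFilter (ultra_mul_set p q).
Proof.
have pU := ultraP p; have qU := ultraP q.
have mulF : ProperFilter (ultra_mul_set p q).
  apply: Build_ProperFilter_ex;
    first by move=> A /(filter_ex (F:=p))[x /(filter_ex (F:=q))[y Axy]];
      exists (x * y).
  split.
  - apply: (filterS (F:=p) _ filterT) => x _.
    exact: (filterS (F:=q) _ filterT).
  - move=> A B pA pB.
    apply: (filterS (F:=p) _ (filterI (F:=p) pA pB)) => x [qA qB].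
    exact: (filterS (F:=q) _ (filterI (F:=q) qA qB)).
  - move=> A B AB; apply: (filterS (F:=p)) => x.
    by apply: (filterS (F:=q)) => y; exact: AB.
split=> // G GF FG; apply/seteqP; split=> // A GA.
have [//|pNA] := in_ultra_setVsetC [set x | ultra q (ltrans_preimage x A)] pU.
suff /FG GNA : ultra_mul_set p q (~` A).
  by have [x []] := filter_ex (filterI GA GNA).
apply: (filterS (F:=p) _ pNA) => x /= nqA.
by have [//|] := in_ultra_setVsetC (ltrans_preimage x A) qU.
Qed.

Definition ultra_mul (p q : stone_cech S) : stone_cech S :=
  StoneCech (ultra_mul_ultra p q).

Lemma ultra_mulA : associative ultra_mul.
Proof.
move=> p q r; apply: ultra_inj => A.
rewrite /ultra_mul/= /ultra_mul_set/= /ltrans_preimage/=.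
by under eq_set do under eq_set do under eq_set do rewrite mulgA.
Qed.

HB.instance Definition _ := isSemigroup.Build (stone_cech S) ultra_mulA.

Definition weakly_cancellative : Prop := forall a b : S,
  finite_set [set x | a * x = b] /\ finite_set [set x | x * a = b].

Definition Fix (a : S) : set S := [set x | x * a = a].

Definition bounded_Fix : Prop :=
  exists k : nat, forall a : S, (Fix a #<= `I_k)%card.

End Product.

Section Ideals.
Variable T : semigroupType.
Local Open Scope group_scope.

(* Ideals of X, where X is a subset of T closed under the product (here S^* in
   beta S). Ideals are nonempty; without this the empty set would be the only
   minimal one. *)
Definition right_ideal_of (X R : set T) : Prop :=
  [/\ R `<=` X, R !=set0 & forall x y, R x -> X y -> R (x * y)].

Definition minimal_right_ideal_of (X R : set T) : Prop :=
  right_ideal_of X R /\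
  forall R', right_ideal_of X R' -> R' `<=` R -> R' = R.

Definition idempotents (R : set T) : set T := [set e | R e /\ e * e = e].

Definition ltrans (r : T) (A : set T) : set T := [set r * e | e in A].

End Ideals.

Section PSpaces.
Variable X : topologicalType.

(* Countable families of neighborhoods are given as sequences. *)
Definition P_point (x : X) : Prop :=
  forall U : nat -> set X, (forall n, nbhs x (U n)) -> nbhs x (\bigcap_n U n).

Definition P_space : Prop := forall x : X, P_point x.

End PSpaces.

(* Main.v *)
Require Import Defs.
From mathcomp Require Import all_boot monoid finmap all_classical topology.

(** Fix an idempotent [e] of [R] and put [q = r * e].  Minimality of [R] makes
each idempotent of [R] a left identity of [R], so [q = q * e = e * q], and every
[x = r * f] of [r * E(R)] satisfies [x * e = r * (f * e) = r * e = q].  Right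
translation by [e] is continuous, hence the whole closure of [r * E(R)] lies in
the fiber [{x | x * e = q}], and it suffices to see that [q] is a P-point of any
subspace of this fiber that contains it.

Given sets [A n] in [q], let [A' n] be the set of the [s] with [A n] in [s * e].
Since [x * e = q], each [A' n] belongs to every [x] of the fiber, while
membership of [s * u] in [A' n] is, for [e]-almost all [u], that of [s], because
[e * e = e].  So the least [n] with [m] outside [A' n] is a level of [m] which
tends to infinity along every [x] of the fiber, simultaneously, and which [m]
keeps under right multiplication by [e]-almost all elements.  Let [B] be the
set of [m] of finite level [n] that lie in [A j] for all [j < n]
([diagonal_set]).  Along any [x] of the fiber that contains [B], levels are
large, so [x] contains all the [A n].  Writing [q = q * e] shows that [B] belongs
to [q], as soon as [q]-almost all elements have a finite level.

Countability and the bound on [Fix] ensure the latter.  As [S] is countable,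
the [A n] can be shrunk so that, for [s] in [S], [s * q] contains all of them
only if [s * q = q].  If [q]-almost all elements had infinite level, then
writing [q = e * q] would give [s * q = q] for [e]-almost all [s] in [S]
([infinite_level_negligible]).  But an ultrafilter invariant under a map
contains the set of its fixed points ([ultra_fixed_points]), so any finitely
many such [s] lie in a common [Fix a]; the bound on [Fix] leaves only finitely
many of them, which is absurd since [e] is not principal. *)

Set Implicit Arguments.
Unset Strict Implicit.
Unset Printing Implicit Defensive.

Local Open Scope classical_set_scope.

#[local] Existing Instance ultraP.

(** * Ultrafilters and the topology of their space *)

Lemma filter_ltn (T : Type) (F : set_system T) (A : nat -> set T) (n : nat) :
  Filter F -> (forall j, (j < n)%N -> F (A j)) ->
  F [set x | forall j, (j < n)%N -> A j x].
Proof.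
move=> FF FA; have FI := filter_forall FF (fun j : 'I_n => FA j (ltn_ord j)).
by apply: filterS FI => x Ax j jn; exact: (Ax (Ordinal jn)).
Qed.

Lemma ultraC (T : Type) (p : stone_cech T) (A : set T) :
  ultra p (~` A) <-> ~ ultra p A.
Proof.
split=> [pNA pA|pNA]; first by have [x []] := filter_ex (filterI pA pNA).
by have [|] := in_ultra_setVsetC A (ultraP p).
Qed.

Lemma ultra_sub_eq (T : Type) (p q : stone_cech T) :
  (forall A, ultra p A -> ultra q A) -> p = q.
Proof.
move=> pq; apply: ultra_inj => A; split; first exact: pq.
by move=> qA; have [//|/ultraC /pq/ultraC//] := pselect (ultra p A).
Qed.

Lemma nbhs_stone_cechP (T : Type) (p : stone_cech T) (U : set (stone_cech T)) :
  nbhs p U <-> exists2 A, ultra p A & basic_clopen A `<=` U.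
Proof.
split=> [[V [[D _ <-] [A DA pA] VU]]|[A pA AU]].
  by exists A => // x Ax; apply: VU; exists A.
exists (basic_clopen A); split=> //; exists [set A] => //.
exact: bigcup_set1.
Qed.

Lemma remainder_finite (T : choiceType) (p : stone_cech T) (F : set T) :
  remainder T p -> finite_set F -> ~ ultra p F.
Proof.
move=> p_np /finite_fsetP[B FB] pF.
have pN x : ultra p (~` [set x]).
  apply/ultraC => px; apply: p_np; exists x => //.
  apply/esym/ultra_sub_eq => A pA.
  by have [y [Ay yx]] := filter_ex (filterI pA px); move=> z ->; rewrite -yx.
have pB : ultra p (\bigcap_(x in [set` B]) ~` [set x]).
  by apply: filter_bigI => x _; exact: pN.
have [x [Fx]] := filter_ex (filterI pF pB); rewrite FB in Fx.
by move=> /(_ x Fx); apply.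
Qed.

(** * Fixed points of a map that preserves an ultrafilter *)

(** [C] or its complement is in [p], and so is its preimage under [f]; a point
of [P] in both contradicts the flip. *)
Lemma no_flip (T : Type) (p : stone_cech T) (f : T -> T) (P C : set T) :
  (forall A, ultra p A -> ultra p (f @^-1` A)) ->
  (forall a, P a -> (C a <-> ~ C (f a))) -> ~ ultra p P.
Proof.
move=> pf Cf pP; have [pC|pC] := in_ultra_setVsetC C (ultraP p).
  have [a [[Pa Ca] Cfa]] := filter_ex (filterI (filterI pP pC) (pf _ pC)).
  by have [/(_ Ca)] := Cf _ Pa.
have [a [[Pa Ca] Cfa]] := filter_ex (filterI (filterI pP pC) (pf _ pC)).
by have [_ /(_ Cfa)] := Cf _ Pa.
Qed.

Section Exit.
Variables (T : Type) (f : T -> T) (P : set T).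

Definition exit_time (a : T) (n : nat) : Prop :=
  (forall i, (i < n)%N -> P (iter i f a)) /\ ~ P (iter n f a).

Definition odd_exit : set T := [set a | exists2 n, exit_time a n & odd n].

Lemma exit_time_inj a m n : exit_time a m -> exit_time a n -> m = n.
Proof.
move=> [Pm Nm] [Pn Nn]; apply/eqP; rewrite eqn_leq; apply/andP; split.
  by rewrite leqNgt; apply/negP => /Pm.
by rewrite leqNgt; apply/negP => /Pn.
Qed.

(** The measure makes every orbit leave [P], and inside [P] one application of
[f] shortens the exit time by one. *)
Lemma odd_exit_flip (mu : T -> nat) :
  (forall a, P a -> (mu (f a) < mu a)%N) ->
  forall a, P a -> (odd_exit a <-> ~ odd_exit (f a)).
Proof.
move=> mu_lt a Pa.
have exit b : exists n, exit_time b n.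
  have [k] := ubnP (mu b); elim: k b => // k IH b bk.
  have [Pb|NPb] := pselect (P b); last by exists 0; split.
  have [n [lt_n Nn]] := IH (f b) (leq_trans (mu_lt _ Pb) bk).
  exists n.+1; split; last by rewrite iterSr.
  by case=> // i; rewrite ltnS iterSr; exact: lt_n.
have [n fan] := exit (f a); have [lt_n Nn] := fan.
have an : exit_time a n.+1.
  split; last by rewrite iterSr.
  by case=> // i; rewrite ltnS iterSr; exact: lt_n.
split=> [[m am odd_m] [k fak odd_k]|nodd].
  move: odd_m; rewrite (exit_time_inj am an) /=.
  by rewrite (exit_time_inj fan fak) odd_k.
by exists n.+1 => //=; apply/negP => odd_n; apply: nodd; exists n.
Qed.

End Exit.

(** Enumerate [T] by [i].  Where [f] decreases the enumeration, orbits are finite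
and the parity of the exit time is a 2-coloring flipped by [f].  Where [f]
increases it, orbits may be infinite, so only the colorings obtained by cutting
at a level [n] make sense; their limit along [p] itself, with [n = i b] and [b]
tending to [p], is again flipped by [f]. *)
Lemma ultra_fixed_points (T : choiceType) (p : stone_cech T) (f : T -> T) :
  countable [set: T] -> remainder T p ->
  (forall A, ultra p A -> ultra p (f @^-1` A)) -> ultra p [set a | f a = a].
Proof.
move=> /countable_injP[i i_injT] p_np pf.
have {i_injT}i_inj : injective i by move=> a b; apply: i_injT; rewrite in_setT.
pose down := [set a | (i (f a) < i a)%N].
pose up := [set a | (i a < i (f a))%N].
have Ndown : ~ ultra p down.
  by apply: no_flip pf _; apply: (odd_exit_flip (mu := i)).
have Nup : ~ ultra p up.
  pose upto n := [set a | (i a < i (f a))%N /\ (i a <= n)%N].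
  pose C := [set a | ultra p [set b | odd_exit f (upto (i b)) a]].
  apply: (no_flip (C := C)) pf _ => a up_a.
  have big : ultra p [set b | (i a <= i b)%N].
    suff : ultra p (~` [set b | (i b < i a)%N]).
      by apply: filterS => b /negP; rewrite -leqNgt.
    apply/ultraC; apply: remainder_finite => //.
    apply: (@finite_preimage _ _ `I_(i a) i); first by move=> x y _ _ /i_inj.
    exact: finite_II.
  have flip b : (i a <= i b)%N ->
      odd_exit f (upto (i b)) a <-> ~ odd_exit f (upto (i b)) (f a).
    move=> ab; apply: (odd_exit_flip (mu := fun c => ((i b).+1 - i c)%N)) => //.
    by move=> c [lt_c cb]; exact: ltn_sub2l.
  split.
    move=> pa; apply/ultraC; apply: filterS (filterI big pa) => b [ab].
    by move/(flip b ab).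
  move=> /ultraC pa; apply: filterS (filterI big pa) => b [ab].
  by move/(flip b ab).
move/ultraC in Ndown; move/ultraC in Nup.
apply: filterS (filterI Ndown Nup) => a [/negP + /negP].
rewrite -!leqNgt => le1 le2; apply: i_inj; apply/eqP.
by rewrite eqn_leq le1 le2.
Qed.

(** * Fibers of right translation by an idempotent *)

Local Open Scope group_scope.

Section Semigroup.
Variable S : semigroupType.
Implicit Types p q e x : stone_cech S.

Lemma ultra_mulE p q A :
  ultra (p * q) A = ultra p [set s | ultra q (ltrans_preimage s A)].
Proof. by []. Qed.

Lemma principal_mulE s p A :
  ultra (principal s * p) A <-> ultra p (ltrans_preimage s A).
Proof.
rewrite ultra_mulE /= /principal_filter /globally /=.
by split=> [/(_ s erefl)|pA _ ->].
Qed.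

(** For finitely many [s] fixing [p], the sets of fixed points of their left
translations meet, at some [a]; these [s] all lie in [Fix a]. *)
Lemma finite_stabilizer p : countable [set: S] -> bounded_Fix S ->
  remainder S p -> finite_set [set s : S | principal s * p = p].
Proof.
move=> S_countable [k Fix_k] p_np; apply: contrapT => stab_inf.
have [B B_stab ltkB] := infinite_set_fset k.+1 stab_inf.
have fixes s : s \in B -> ultra p [set a | s * a = a].
  move=> /B_stab /= sp; apply: ultra_fixed_points => // A pA.
  by apply/principal_mulE; rewrite sp.
have /filter_ex[a aB] : ultra p (\bigcap_(s in [set` B]) [set a | s * a = a]).
  exact: filter_bigI.
have Bk : ([set` B] #<= `I_k)%card.
  by apply: card_le_trans (Fix_k a); apply: subset_card_le => s /aB.
move: ltkB; rewrite ltnNge => /negP; apply.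
by have := geq_card_fset_set Bk; rewrite set_fsetK.
Qed.

(** A pseudo-intersection of the [A n] on the fiber of [q]; the hypothesis on
[q] says that the level, defined as the least [n] with [m] outside [A' n], is
finite [q]-almost everywhere. *)
Lemma diagonal_set q e (A : nat -> set S) :
  q * e = q -> e * e = e -> (forall n, ultra q (A n)) ->
  ~ ultra q [set s | forall n, ultra e (ltrans_preimage s (A n))] ->
  exists2 B, ultra q B &
    forall x, x * e = q -> ultra x B -> forall n, ultra x (A n).
Proof.
move=> qe ee qA /ultraC q_finite.
pose A' n := [set s | ultra e (ltrans_preimage s (A n))].
pose B := [set m | exists2 n, ~ A' n m & forall j, (j < n)%N -> A' j m /\ A j m].
have A'_shift s n : ultra e [set u | A' n (s * u)] <-> A' n s.
  rewrite /A' /= -{3}ee; rewrite /ltrans_preimage.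
  by under eq_set do under eq_set do rewrite -mulgA.
have xA' x n : x * e = q -> ultra x (A' n).
  by move=> xe; have := qA n; rewrite -xe.
exists B.
  rewrite -qe; apply: filterS q_finite => s /= /existsNP s_out.
  have [n sN lt_n] : exists2 n, ~ A' n s & forall j, (j < n)%N -> A' j s.
    have [N] := s_out; have [k] := ubnP N; elim: k N => // k IH N Nk sN.
    have [lt_N|] := pselect (forall j, (j < N)%N -> A' j s); first by exists N.
    move=> /existsNP[j] /not_implyP[jN sj].
    by apply: IH sj; exact: leq_trans jN Nk.
  (* For e-almost all u, the element s * u has the same level n as s. *)
  have eN : ultra e [set u | ~ A' n (s * u)] by apply/ultraC; rewrite A'_shift.
  have elt :
      ultra e [set u | forall j, (j < n)%N -> A' j (s * u) /\ A j (s * u)].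
    apply: filter_ltn => j /lt_n sj; apply: filterI => //.
    exact/A'_shift.
  by apply: filterS (filterI eN elt) => u [? ?]; exists n.
move=> x xe xB n.
have xlt : ultra x [set m | forall j, (j < n.+1)%N -> A' j m].
  by apply: filter_ltn => j _; exact: xA'.
apply: filterS (filterI xB xlt) => m [[N mN lt_N] mlt].
have ltnN : (n < N)%N by rewrite ltnNge; apply/negP => /mlt.
by have [] := lt_N n ltnN.
Qed.

(** Otherwise, [q = e * q] provides, for [e]-almost all [s], that [A n] belongs
to [s * q * e = s * q] for all [n], hence that [s] fixes [q]; but only finitely
many [s] do. *)
Lemma infinite_level_negligible q e (A : nat -> set S) :
  countable [set: S] -> bounded_Fix S -> remainder S q -> remainder S e ->
  q * e = q -> e * q = q ->
  (forall s : S, (forall n, ultra (principal s * q) (A n)) ->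
    principal s * q = q) ->
  ~ ultra q [set s | forall n, ultra e (ltrans_preimage s (A n))].
Proof.
move=> S_countable S_Fix q_np e_np qe eq_q Asep.
rewrite -{1}eq_q ultra_mulE => eA.
apply: (remainder_finite e_np (finite_stabilizer S_countable S_Fix q_np)).
apply: filterS eA => s sA; apply: Asep => n; apply/principal_mulE.
suff : ultra (q * e) (ltrans_preimage s (A n)) by rewrite qe.
rewrite ultra_mulE; apply: filterS sA => u /(_ n); apply: filterS => v.
by rewrite /ltrans_preimage /= mulgA.
Qed.

(** Right translation by [e] is continuous and points are closed. *)
Lemma closure_fiber e q (X : set (stone_cech S)) :
  (forall x, X x -> x * e = q) -> forall x, closure X x -> x * e = q.
Proof.
move=> Xe x clx; apply: ultra_sub_eq => A.
rewrite ultra_mulE; set A' := [set s | _] => xA'.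
have /clx[y [Xy yA']] : nbhs x (basic_clopen A').
  by apply/nbhs_stone_cechP; exists A'.
by rewrite -(Xe y Xy).
Qed.

Lemma fiber_P_point q e (Y : set (stone_cech S)) (y : set_type Y) :
  countable [set: S] -> bounded_Fix S -> remainder S q -> remainder S e ->
  q * e = q -> e * q = q -> e * e = e ->
  (forall x, Y x -> x * e = q) -> set_val y = q -> P_point y.
Proof.
move=> S_countable S_Fix q_np e_np qe eq_q ee Ye yq U yU.
have {yU} /choice[V VP] n : exists V, ultra q V /\
    forall x : set_type Y, ultra (set_val x) V -> U n x.
  have [W [[W' oW' <-] W'y W'U]] := yU n.
  have /nbhs_stone_cechP[V qV VW'] : nbhs q W'.
    by rewrite -yq; exact: open_nbhs_nbhs.
  by exists V; split=> // x xV; apply/W'U/VW'.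
have /choice[C CP] s : exists C, ultra q C /\
    (ultra (principal s * q) C -> principal s * q = q).
  have [sq|sq] := pselect (principal s * q = q).
    by exists setT; split=> //; exact: filterT.
  apply: contrapT => /forallNP nC; apply/sq/esym/ultra_sub_eq => C qC.
  by apply: contrapT => sqC; exact: (nC C).
have /countable_injP[i i_injT] := S_countable.
have {i_injT}i_inj : injective i by move=> a b; apply: i_injT; rewrite in_setT.
(* The second condition bears on the at most one s with i s = n. *)
pose A n := [set m | V n m /\ forall s, i s = n -> C s m].
have qA n : ultra q (A n).
  apply: filterI; first by have [] := VP n.
  have [[s <-]|n_out] := pselect (exists s, i s = n).
    by apply: filterS (proj1 (CP s)) => m sm t /i_inj ->.
  by apply: filterS filterT => m _ s sn; case: n_out; exists s.
have Asep s : (forall n, ultra (principal s * q) (A n)) -> principal s * q = q.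
  move=> sA; apply: (proj2 (CP s)).
  move: (sA (i s)); apply: (filterS (F := ultra (principal s * q))).
  by move=> m [_ /(_ s erefl)].
have [B qB BA] := diagonal_set qe ee qA
  (infinite_level_negligible S_countable S_Fix q_np e_np qe eq_q Asep).
exists (set_val @^-1` basic_clopen B); split=> [||x xB n _].
- by exists (basic_clopen B) => //; exists [set B] => //; exact: bigcup_set1.
- by move: qB; rewrite -yq.
- have [_ VU] := VP n; apply: VU.
  by apply: filterS (BA _ (Ye _ (set_valP x)) xB n) => m [].
Qed.

End Semigroup.

(** * Minimal right ideals *)

(** The elements fixed by left multiplication by [e] form a right ideal inside
[R], which contains [e]. *)
Lemma idempotent_left_identity (T : semigroupType) (X R : set T) (e x : T) :
  minimal_right_ideal_of X R -> idempotents R e -> R x -> e * x = x.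
Proof.
move=> [[RX _ Rmul] R_min] [Re ee] Rx.
suff fixed : [set y | R y /\ e * y = y] = R by rewrite -fixed in Rx; case: Rx.
apply: R_min => [|y []//]; split=> [y [/RX]//||y z [Ry ey] Xz].
  by exists e.
by split; [exact: Rmul|rewrite mulgA ey].
Qed.

Theorem theorem3p14 (S : semigroupType)
  (S_infinite : infinite_set [set: S])
  (S_countable : countable [set: S])
  (S_wcancel : weakly_cancellative S)
  (S_Fix : bounded_Fix S)
  (R : set (stone_cech S))
  (R_min : minimal_right_ideal_of (remainder S) R)
  (r : stone_cech S) (Rr : R r) :
  (forall q : set_type (closure (ltrans r (idempotents R))),
     ltrans r (idempotents R) (set_val q) -> P_point q)
  /\ P_space (set_type (ltrans r (idempotents R))).
Proof.
have [[R_np _ Rmul] _] := R_min.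
pose X := ltrans r (idempotents R).
have X_point (Y : set (stone_cech S)) (y : set_type Y) :
    Y `<=` closure X -> X (set_val y) -> P_point y.
  move=> YX [e eE re_y]; have [Re ee] := eE.
  have Rre : R (r * e) by apply: Rmul => //; exact: R_np.
  have Xe x : X x -> x * e = r * e.
    move=> [f fE <-]; rewrite -mulgA.
    by rewrite (idempotent_left_identity R_min fE Re).
  apply: (@fiber_P_point _ (r * e) e) => //.
  - exact: R_np.
  - exact: R_np.
  - by rewrite -mulgA ee.
  - exact: idempotent_left_identity R_min eE Rre.
  - by move=> x /YX; exact: closure_fiber Xe x.
split=> [q|q]; first exact: X_point.
by apply: X_point; [exact: subset_closure|exact: set_valP].
Qed.
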